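(* For any $k>0$, the $C_n$-ellipse $$E_{C_n}(k) = \{z\in\mathbb{R}^p : z'C_nz\le k\}$$ satisfies Condition A with matrix $\bar C = C_n$.
   Context: $C_n = X'X/n$, where $X$ is a real $n\times p$ matrix of full column rank $p$ (so $C_n$ is symmetric positive definite). For $m \in \mathbb{R}^p$, $d \in \{-1,1\}^p$ and $\bar C \in \mathbb{R}^{p\times p}$ let $A^d_{\bar C}(m) = \bigcap_{j=1}^p\{z \in \mathbb{R}^p : d_j(\bar Cm)_j \le d_j(\bar Cz)_j,\ d_jz_j \le 0\}$. A set $M\subseteq \mathbb{R}^p$ satisfies Condition A with matrix $\bar C$ if $A^d_{\bar C}(m) \subseteq M$ for all $d \in \{-1,1\}^p$ and all $m \in M$. *)

(* Defs.v *)
From mathcomp Require Import all_boot all_order all_algebra.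
From mathcomp Require Import classical_sets reals.

Set Implicit Arguments.
Unset Strict Implicit.
Unset Printing Implicit Defensive.

Import Order.TTheory GRing.Theory Num.Theory.

Local Open Scope classical_set_scope.
Local Open Scope ring_scope.

Definition gram (R : realType) (n p : nat) (X : 'M[R]_(n, p)) : 'M[R]_p :=
  n%:R^-1 *: (X^T *m X).

Definition sign_vectors (R : realType) (p : nat) : set 'cV[R]_p :=
  [set d | forall j, d j 0 = -1 \/ d j 0 = 1].

Definition condA_region (R : realType) (p : nat) (C : 'M[R]_p)
    (d m : 'cV[R]_p) : set 'cV[R]_p :=
  \bigcap_(j : 'I_p)
    [set z : 'cV[R]_p | d j 0 * (C *m m) j 0 <= d j 0 * (C *m z) j 0
                        /\ d j 0 * z j 0 <= 0].

Definition conditionA (R : realType) (p : nat) (C : 'M[R]_p)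
    (M : set 'cV[R]_p) : Prop :=
  forall d m : 'cV[R]_p,
    sign_vectors d -> M m -> condA_region C d m `<=` M.

(* The 1 x 1 matrix z^T *m C *m z is read as its unique entry. *)
Definition ellipse (R : realType) (p : nat) (C : 'M[R]_p) (k : R) :
    set 'cV[R]_p :=
  [set z | (z^T *m C *m z) 0 0 <= k].

(* Main.v *)
Require Import Defs.
From mathcomp Require Import all_boot all_order all_algebra.
From mathcomp Require Import classical_sets reals.
From mathcomp Require Import lra.

(** Write C for the Gram matrix, let m lie in the ellipse and z in the region
    attached to m and to a sign vector d. The two sign conditions at index j
    say that z_j and (C z - C m)_j have weakly opposite signs, whatever d_j is;
    summing the products over j gives z' C z <= z' C m
    ([condA_region_form_le]). Because C is symmetric and positive semidefinite,
    expanding 0 <= (z - m)' C (z - m) bounds 2 z' C m by z' C z + m' C m.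
    Together, z' C z <= m' C m <= k: moving from m to z can only decrease the
    quadratic form. *)

Import Order.TTheory GRing.Theory Num.Theory.

Local Open Scope ring_scope.

Lemma gram_sym (R : realType) (n p : nat) (X : 'M[R]_(n, p)) :
  (gram X)^T = gram X.
Proof. by rewrite /gram linearZ /= trmx_mul trmxK. Qed.

Lemma gram_form_ge0 (R : realType) (n p : nat) (X : 'M[R]_(n, p))
    (z : 'cV[R]_p) :
  0 <= (z^T *m gram X *m z) 0 0.
Proof.
have -> : z^T *m gram X *m z = n%:R^-1 *: ((X *m z)^T *m (X *m z)).
  by rewrite /gram -scalemxAr -scalemxAl trmx_mul !mulmxA.
rewrite mxE mulr_ge0 ?invr_ge0 ?ler0n // mxE sumr_ge0 // => i _.
by rewrite [_^T _ _]mxE -expr2 sqr_ge0.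
Qed.

Lemma sym_form_comm (R : realType) (p : nat) (C : 'M[R]_p) (u v : 'cV[R]_p) :
  C^T = C -> (u^T *m C *m v) 0 0 = (v^T *m C *m u) 0 0.
Proof.
move=> C_sym; have -> : v^T *m C *m u = (u^T *m C *m v)^T.
  by rewrite !trmx_mul trmxK C_sym mulmxA.
by rewrite [RHS]mxE.
Qed.

(** Termwise comparison: multiplying the two sign conditions at j cancels the
    sign, since d_j ^ 2 = 1, and leaves z_j (C z)_j <= z_j (C m)_j. *)
Lemma condA_region_form_le (R : realType) (p : nat) (C : 'M[R]_p)
    (d m z : 'cV[R]_p) :
  sign_vectors d -> condA_region C d m z ->
  (z^T *m C *m z) 0 0 <= (z^T *m C *m m) 0 0.
Proof.
move=> d_sign z_region; rewrite -!mulmxA [leLHS]mxE [leRHS]mxE.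
apply: ler_sum => j _; rewrite [z^T _ _]mxE.
have [dCm_le dz_le0] := z_region j I.
by case: (d_sign j) dCm_le dz_le0 => ->; nra.
Qed.

(** Symmetry makes the two cross terms of (z - m)' C (z - m) equal, so that
    nonnegativity of this form turns z' C z <= z' C m into
    z' C z <= m' C m. *)
Lemma psd_ellipse_conditionA (R : realType) (p : nat) (C : 'M[R]_p) (k : R) :
  C^T = C -> (forall v : 'cV[R]_p, 0 <= (v^T *m C *m v) 0 0) ->
  conditionA C (ellipse C k).
Proof.
move=> C_sym C_psd d m d_sign m_in z z_region; rewrite /ellipse /= in m_in *.
have zz_le_zm := condA_region_form_le _ _ _ _ _ _ d_sign z_region.
have := C_psd (z - m).
have -> : ((z - m)^T *m C *m (z - m)) 0 0 =
    (z^T *m C *m z) 0 0 - (z^T *m C *m m) 0 0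
    - ((m^T *m C *m z) 0 0 - (m^T *m C *m m) 0 0).
  by rewrite [(z - m)^T]linearB /= !mulmxBl !mulmxBr !mxE.
rewrite (sym_form_comm _ _ _ m z C_sym); lra.
Qed.

Theorem proposition3 (R : realType) (n p : nat) (X : 'M[R]_(n, p))
    (X_full_col_rank : \rank X = p) (k : R) (k_gt0 : 0 < k) :
  conditionA (gram X) (ellipse (gram X) k).
Proof.
exact: psd_ellipse_conditionA _ _ _ _ (gram_sym _ _ _ X) (gram_form_ge0 _ _ _ X).
Qed.
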